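(* Let $M$ be a bounded acyclic matching on a connected (possibly infinite) simplicial complex $S$. If the critical simplices of $M$ form a subcomplex $S_c$ of $S$, then $|S_c|$ is a deformation retract of $|S|$.
   Context: A simplicial complex on a nonempty set $V$ is a collection $S$ of nonempty (finite) subsets of $V$ such that nonempty subsets of members of $S$ belong to $S$; $|S|$ is its geometric realization. A partial matching on $S$ is a subset $M\subseteq S\times S$ such that $(b,a)\in M$ implies $b\subset a$ and $|a\setminus b|=1$, and each simplex belongs to at most one pair of $M$. If $(b,a)\in M$ write $b\vdash a$. $M$ is acyclic if there is no cycle $a_1\supset b_1\vdash a_2\supset b_2\vdash\cdots\vdash a_p\supset b_p\vdash a_{p+1}=a_1$ with $p\ge 2$ and $a_1,\dots,a_p$ pairwise distinct. A simplex is critical if it belongs to no pair of $M$. An acyclic matching $M$ is bounded if for each simplex $a\in S$ there is a positive integer $N(a)$ such that every sequence $a=a_1\supset b_1\vdash a_2\supset b_2\vdash\cdots\vdash a_p\supset b_p$ with $a_i\ne a_j$, $b_i\ne b_j$ for $i\ne j$ satisfies $p\le N(a)$. *)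

(* Defs.v *)
From HB Require Import structures.
From mathcomp Require Import all_boot all_order all_algebra finmap.
From mathcomp Require Import all_classical all_reals all_analysis.
Import Order.TTheory GRing.Theory Num.Theory.
Import numFieldNormedType.Exports.

Set Implicit Arguments.
Unset Strict Implicit.
Unset Printing Implicit Defensive.

Local Open Scope classical_set_scope.
Local Open Scope ring_scope.

Section Complexes.
Context {V : choiceType}.
Implicit Types (S K : set {fset V}) (M : set ({fset V} * {fset V})).

Definition simplicial_complex S : Prop :=
  (forall a, S a -> a != fset0%fset) /\
  (forall a b, S a -> (b `<=` a)%fset -> b != fset0%fset -> S b).

Definition subcomplex K S : Prop := K `<=` S /\ simplicial_complex K.

(* [M (b, a)] is [b |- a]: the smaller simplex comes first. *)
Definition partial_matching S M : Prop :=
  [/\ forall b a, M (b, a) -> S b /\ S a,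
      forall b a, M (b, a) -> (b `<=` a)%fset /\ #|` (a `\` b)%fset| = 1%N &
      forall c p q, M p -> M q ->
        (c = p.1 \/ c = p.2) -> (c = q.1 \/ c = q.2) -> p = q].

Definition critical S M : set {fset V} :=
  [set c | S c /\ forall b a, M (b, a) -> c <> b /\ c <> a].

(* The sequence a_0 > b_0 |- a_1 > b_1 |- ... |- a_(p-1) > b_(p-1), of which only
   the values at indices i < p matter. Inclusions are proper, and are not
   required to be of codimension 1. *)
Definition alternating_path S M (p : nat) (a b : nat -> {fset V}) : Prop :=
  [/\ forall i, (i < p)%N -> S (a i) /\ S (b i),
      forall i, (i < p)%N -> (b i `<` a i)%fset &
      forall i, (i.+1 < p)%N -> M (b i, a i.+1)].

Definition distinct_below (p : nat) (a : nat -> {fset V}) : Prop :=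
  forall i j, (i < p)%N -> (j < p)%N -> a i = a j -> i = j.

Definition acyclic_matching S M : Prop :=
  ~ exists (p : nat) (a b : nat -> {fset V}),
      [/\ (2 <= p)%N, alternating_path S M p a b, M (b p.-1, a 0%N) &
          distinct_below p a].

Definition bounded_matching S M : Prop :=
  forall a0, S a0 -> exists2 N : nat, (0 < N)%N &
    forall (p : nat) (a b : nat -> {fset V}), (0 < p)%N -> a 0%N = a0 ->
      alternating_path S M p a b -> distinct_below p a -> distinct_below p b ->
      (p <= N)%N.

End Complexes.

Section Realization.
Context {V : choiceType} (R : realType).
Implicit Types (S K : set {fset V}).

Definition closed_simplex (s : {fset V}) : set {ptws V -> R} :=
  [set x | [/\ forall v, 0 <= x v,
               forall v, v \notin s -> x v = 0 &
               \sum_(v <- s) x v = 1]].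

Definition polyhedron S : set {ptws V -> R} :=
  \bigcup_(s in S) closed_simplex s.

Definition realization S := set_type (polyhedron S).

Definition bary S (x : realization S) : {ptws V -> R} := set_val x.

HB.instance Definition _ S :=
  Choice.copy (realization S) (set_type (polyhedron S)).

(* The weak topology: a set is open when its trace on each closed simplex is
   relatively open there. All points of a closed simplex are supported on the
   same finite set, so pointwise convergence induces on it the Euclidean topology. *)
Definition realization_open S : set (set (realization S)) :=
  [set U | forall s, S s ->
     open (bary (S := S) @` U : set (subspace (closed_simplex s)))].

Lemma realization_openP S (U : set (realization S)) :
  realization_open U <->
  forall s, S s -> exists2 W : set {ptws V -> R}, open W &
    forall x, closed_simplex s (bary x) -> (U x <-> W (bary x)).
Proof.
have inj : injective (bary (S := S)) by move=> x y; exact: val_inj.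
split=> [oU s Ss|oU s Ss].
- have /open_subspaceP[W openW WU] := oU s Ss.
  exists W => // x xs; split=> [Ux|Wx].
  + have : setI (bary (S := S) @` U) (closed_simplex s) (bary x).
      by split=> //; exists x.
    by rewrite -WU => -[].
  + have : setI W (closed_simplex s) (bary x) by split.
    by rewrite WU => -[[y Uy /inj <-]].
- have [W openW WU] := oU s Ss.
  apply/open_subspaceP; exists W => //.
  apply/seteqP; split=> z [zW zs]; split=> //.
  + have zS : polyhedron S z by exists s.
    by exists (SigSub (mem_set zS)) => //; apply/WU.
  + by case: zW zs => y Uy <- ys; apply/(WU y ys).
Qed.

Fact realization_openT S : realization_open [set: realization S].
Proof. by apply/realization_openP => s _; exists setT => //; exact: openT. Qed.

Fact realization_openI S : setI_closed (@realization_open S).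
Proof.
move=> A B /realization_openP oA /realization_openP oB.
apply/realization_openP => s Ss.
have [[W openW WA] [P oP PB]] := (oA s Ss, oB s Ss).
exists (W `&` P); first exact: openI.
by move=> x xs; split=> -[/(WA x xs) ? /(PB x xs) ?].
Qed.

Fact realization_open_bigU S (I : Type) (f : I -> set (realization S)) :
  (forall i, realization_open (f i)) -> realization_open (\bigcup_i f i).
Proof.
move=> of_; apply/realization_openP => s Ss.
pose G := [set W : set {ptws V -> R} | open W /\ exists i,
  forall x, closed_simplex s (bary x) -> (f i x <-> W (bary x))].
exists (\bigcup_(W in G) W); first by apply: bigcup_open => W [].
move=> x xs; split=> [[i _ fx]|[W [_ [i fW]] Wx]].
- have /realization_openP/(_ s Ss)[W openW fW] := of_ i.
  by exists W; [split=> //; exists i | apply/fW].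
- by exists i => //; apply/fW.
Qed.

HB.instance Definition _ S := isOpenTopological.Build (realization S)
  (@realization_openT S) (@realization_openI S) (@realization_open_bigU S).

Definition subrealization S K : set (realization S) :=
  [set x | polyhedron K (bary x)].

(* There is a homotopy, fixing [A] pointwise at all times, from the identity to
   a map onto [A]. Only its values at times in [0, 1] are relevant. *)
Definition deformation_retract (X : topologicalType) (A : set X) : Prop :=
  exists H : X * R -> X,
    [/\ {within [set: X] `*` `[0, 1]%classic, continuous H},
        forall x, H (x, 0) = x,
        forall x, A (H (x, 1)) &
        forall (x : X) (t : R), A x -> 0 <= t <= 1 -> H (x, t) = x].

End Realization.

Arguments subrealization {V} R S K.
Arguments deformation_retract R {X} A.

(* Main.v *)
(* Collapsing a matched pair (b, a) with b a free face of a pushes a along the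
   vector that moves mass from the vertices of b to the vertex of a \ b, until
   some coordinate of b vanishes; this is the piecewise linear retraction of a
   onto its other proper faces. Boundedness gives each simplex a finite rank,
   zero exactly on the critical simplices, such that both members of a matched
   pair have the same rank and every other proper face of the larger one has
   smaller rank. So, in the subcomplex of rank at most n, the pairs of rank n can
   be collapsed simultaneously, and this is done during the time interval
   [2^-n, 2^(1-n)]. A point of a simplex of rank n does not move before time 2^-n,
   hence the infinite concatenation is a finite one on each simplex. *)
Require Import Defs.
From mathcomp Require Import all_boot all_order all_algebra finmap.
From mathcomp Require Import all_classical all_reals all_analysis.
From mathcomp Require Import lra.
Import Order.TTheory GRing.Theory Num.Theory.
Import numFieldNormedType.Exports.

Set Implicit Arguments.
Unset Strict Implicit.
Unset Printing Implicit Defensive.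

Local Open Scope classical_set_scope.
Local Open Scope ring_scope.

(** * Rank of a bounded matching *)

Section Rank.
Context {V : choiceType} (S : set {fset V}) (M : set ({fset V} * {fset V})).
Context (hS : simplicial_complex S).
Context (hM : partial_matching S M).

(** The default value [fset0], also used for [upper_mate], is never a simplex of [S]. *)
Definition lower_mate (a : {fset V}) : {fset V} :=
  xget fset0 [set b | M (b, a)].

Definition upper_mate (b : {fset V}) : {fset V} :=
  xget fset0 [set a | M (b, a)].

Lemma matching_share b a b' a' c :
  M (b, a) -> M (b', a') -> c = b \/ c = a -> c = b' \/ c = a' ->
  b' = b /\ a' = a.
Proof.
by case: hM => _ _ uM Mba Mba' cba cba'; have [-> ->] := uM c _ _ Mba' Mba cba' cba.
Qed.

Lemma lower_mateP b a : M (b, a) -> lower_mate a = b.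
Proof.
move=> Mba; apply: xget_unique => // b' Mb'a.
by have [] := matching_share Mba Mb'a (or_intror erefl) (or_intror erefl).
Qed.

Lemma upper_mateP b a : M (b, a) -> upper_mate b = a.
Proof.
move=> Mba; apply: xget_unique => // a' Mba'.
by have [] := matching_share Mba Mba' (or_introl erefl) (or_introl erefl).
Qed.

Lemma matching_fsub b a : M (b, a) -> (b `<` a)%fset.
Proof.
case: hM => _ cM _ /cM[ba c1]; rewrite fproperEneq ba andbT.
by apply/eqP => e; move: c1; rewrite e fsetDv cardfs0.
Qed.

Lemma matching_fsetU1 b a : M (b, a) ->
  exists2 v, v \notin b & a = (v |` b)%fset.
Proof.
case: hM => _ cM _ /cM[ba /eqP /cardfs1P[v abv]].
have : v \in (a `\` b)%fset by rewrite abv inE.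
rewrite inE => /andP[vb va]; exists v => //.
apply/fsetP => w; have : (w \in (a `\` b)%fset) = (w == v) by rewrite abv inE.
rewrite !inE => <-; case: (boolP (w \in b)) => [/(fsubsetP ba)->|_] //=.
by rewrite orbF.
Qed.

(** One step $a \supset b \vdash a'$ of an alternating path. As $b$ is recovered from $a'$, a path
    is coded by its larger simplices alone. The clause [a' <> a] excludes going back up along the
    pair of [a]. *)
Definition descent (a a' : {fset V}) : bool :=
  `[< [/\ M (lower_mate a', a'), (lower_mate a' `<` a)%fset & a' <> a] >].

Context (hacyclic : acyclic_matching S M).

Lemma matching_simplex b a : M (b, a) -> S b /\ S a.
Proof. by case: hM => + _ _; apply. Qed.

Lemma descent_uniq a s : path descent a s -> uniq (a :: s).
Proof.
elim/last_ind: s => [//|s z IH]; rewrite rcons_path => /andP[pas dz].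
have u := IH pas; rewrite -rcons_cons rcons_uniq u andbT.
apply/negP => /splitPl zs; case: zs pas u dz => s1 s2 s1z.
rewrite cat_path s1z last_cat s1z => /andP[_ ps2] u dz.
(* The segment from the earlier occurrence of [z] onwards, closed by the return to [z], is the
   forbidden cycle; [b i] is matched with its cyclically next simplex. *)
apply: hacyclic; pose b i := lower_mate (nth z (rcons s2 z) i).
have pz : path descent z (rcons s2 z) by rewrite rcons_path ps2.
have nthS i : (i < (size s2).+1)%N ->
    nth z (z :: s2) i = nth z (z :: rcons s2 z) i.
  by case: i => //= i; rewrite ltnS nth_rcons => ->.
have step i : (i < (size s2).+1)%N ->
    descent (nth z (z :: s2) i) (nth z (rcons s2 z) i).
  move=> ip; rewrite nthS //; move/pathP : pz; apply.
  by rewrite size_rcons.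
exists (size s2).+1, (nth z (z :: s2)), b; split.
(* A cycle through one simplex would be a descent from [z] to itself. *)
- case: s2 {u ps2 pz nthS step b} dz => // /asboolP[_ _]; exact.
- split=> i ip.
  + have /asboolP[/matching_simplex[Sb _] _ _] := step _ ip; split=> // {Sb}.
    case: i ip => [|i] ip /=.
      have /asboolP[/matching_simplex[]] := step (size s2) (ltnSn _).
      by rewrite nth_rcons ltnn eqxx.
    have /asboolP[/matching_simplex[]] := step i (ltnW ip).
    by rewrite nth_rcons (ip : (i < size s2)%N).
  + by have /asboolP[] := step _ ip.
  + have /asboolP[] := step _ (ltnW ip).
    by rewrite /b nth_rcons (ip : (i < size s2)%N).
- by have /asboolP[] := step _ (ltnSn _); rewrite /b nth_rcons ltnn eqxx.
- move=> i j ip jp /eqP; rewrite nth_uniq // => [/eqP //|].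
  move: u; rewrite -cat_cons cat_uniq => /and3P[u1 h u2] /=; rewrite u2 andbT.
  by apply/negP => zs2; move/hasP: h; apply; exists z; rewrite // -s1z mem_last.
Qed.

Context (hbounded : bounded_matching S M).

(** A descent of $k$ steps, its last simplex dropped, gives an alternating path with $k$ pairs $a_i
    \supset b_i$. The $a_i$ are distinct by [descent_uniq], and so are the $b_i$, since each
    determines its mate. *)
Lemma descent_bounded a : S a ->
  exists N : nat, forall s, path descent a s -> (size s <= N)%N.
Proof.
move=> Sa; have [N _ hN] := hbounded Sa; exists N => s pas.
case: (posnP (size s)) => [->//|s0].
have /andP[/= _ us] := descent_uniq pas.
have step i : (i < size s)%N -> descent (nth a (a :: s) i) (nth a s i).
  by move=> ip; move/pathP : pas; apply.
apply: (hN _ (nth a (a :: s)) (fun i => lower_mate (nth a s i))) => //.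
- split=> i ip.
  + have /asboolP[/matching_simplex[Sb _] _ _] := step _ ip; split=> // {Sb}.
    case: i ip => [//|i] ip /=.
    by have /asboolP[/matching_simplex[]] := step i (ltnW ip).
  + by have /asboolP[] := step _ ip.
  + by have /asboolP[] := step _ (ltnW ip).
- move=> i j ip jp /eqP; rewrite nth_uniq ?descent_uniq //=; try by [].
  by move=> /eqP.
  by rewrite ltnW.
  by rewrite ltnW.
- move=> i j ip jp e; apply/eqP; rewrite -(nth_uniq a ip jp us); apply/eqP.
  have /asboolP[Mi _ _] := step _ ip; have /asboolP[Mj _ _] := step _ jp.
  by rewrite -(upper_mateP Mi) -(upper_mateP Mj) e.
Qed.

(** [L a] is the maximal length of a descent from [a]; prepending the step from [a] to [a']
    lengthens any descent from [a']. *)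
Lemma exists_descent_length : exists L : {fset V} -> nat,
  forall a a', S a -> S a' -> descent a a' -> (L a' < L a)%N.
Proof.
pose P a n := `[< exists2 s, path descent a s & size s = n >].
have /choice[L HL] : forall a, exists n, S a -> P a n /\ forall m, P a m -> (m <= n)%N.
  move=> a; have [Sa|nSa] := pselect (S a); last by exists 0%N.
  have [N hN] := descent_bounded Sa.
  have P0 : exists n, P a n by exists 0%N; apply/asboolP; exists [::].
  have PN m : P a m -> (m <= N)%N by move=> /asboolP[s /hN + <-].
  by exists (ex_maxn P0 PN) => _; case: ex_maxnP.
exists L => a a' Sa Sa' aa'; have [/asboolP[s pas <-] _] := HL _ Sa'.
have [_] := HL _ Sa; apply; apply/asboolP; exists (a' :: s) => //=.
by rewrite aa'.
Qed.

Definition matched (c : {fset V}) : Prop :=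
  exists b a, M (b, a) /\ (c = b \/ c = a).

Lemma not_critical_matched c : S c -> ~ critical S M c -> matched c.
Proof.
move=> Sc nc; apply: contrapT => nm; apply: nc; split=> // b a Mba.
by split=> e; apply: nm; exists b, a; split=> //; [left|right].
Qed.

(* A matched simplex gets one more than the length of the longest descent from
   the larger simplex of its pair. *)
Lemma exists_rank : exists h : {fset V} -> nat,
  [/\ forall c, critical S M c -> h c = 0%N,
      forall c, matched c -> (0 < h c)%N,
      forall b a, M (b, a) -> h b = h a &
      forall b a c, M (b, a) -> (c `<` a)%fset -> c != fset0%fset -> c != b ->
        (h c < h a)%N].
Proof.
have [L HL] := exists_descent_length.
pose top c := xget fset0 [set a | exists b, M (b, a) /\ (c = b \/ c = a)].
have topP b a c : M (b, a) -> c = b \/ c = a -> top c = a.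
  move=> Mba ca; apply: xget_unique; first by exists b.
  by move=> a' [b' [Mba' ca']]; have [] := matching_share Mba Mba' ca ca'.
pose h c := if `[< matched c >] then (L (top c)).+1 else 0%N.
have hE b a c : M (b, a) -> c = b \/ c = a -> h c = (L a).+1.
  move=> Mba ca; rewrite /h (topP _ _ _ Mba ca); case: asboolP => // -[].
  by exists b, a.
have h0 c : critical S M c -> h c = 0%N.
  move=> [_ cc]; rewrite /h; case: asboolP => // -[b [a [/cc[nb na]]]].
  by case.
exists h; split=> //.
- by move=> c mc; rewrite /h; case: asboolP.
- by move=> b a Mba; rewrite !(hE _ _ _ Mba); [|right|left].
- move=> b a c Mba ca c0 cb; rewrite (hE _ _ _ Mba (or_intror erefl)).
  have [_ Sa] := matching_simplex Mba.
  have Sc : S c by case: hS => _; apply; [exact: Sa|exact: fproper_sub|].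
  have [/h0->//|] := pselect (critical S M c).
  move=> /(not_critical_matched Sc)[b' [a' [Mb'a' cb'a']]].
  rewrite (hE _ _ _ Mb'a' cb'a') ltnS; have [_ Sa'] := matching_simplex Mb'a'.
  (* The mate [b'] lies in [c], hence properly in [a], so [a'] is one descent step below [a]; if
     [a'] were [a], then [c] would be [b] or [a]. *)
  apply: HL => //; apply/asboolP; rewrite (lower_mateP Mb'a'); split=> //.
    case: cb'a' => e; move: ca; rewrite e //.
    exact: fsub_proper_trans (fproper_sub (matching_fsub Mb'a')).
  move=> e; move: Mb'a' cb'a'; rewrite e => Mb'a.
  have [-> _] := matching_share Mba Mb'a (or_intror erefl) (or_intror erefl).
  by case=> e'; move: cb ca; rewrite e' ?eqxx ?(negbTE (fproper_irrefl _)).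
Qed.

End Rank.

(** * Collapsing a matched pair *)

Section Push.
Context {V : choiceType} {R : realType}.
Implicit Types (x : V -> R) (a b s : {fset V}).

Lemma closed_simplex_sub s s' x :
  (s `<=` s')%fset -> closed_simplex s x -> closed_simplex s' x.
Proof.
move=> ss' [x0 xs x1]; split=> // [v vs'|].
  by apply: xs; apply: contra vs' => /(fsubsetP ss').
by rewrite -x1; apply/esym/big_fset_incl => // v _ /xs.
Qed.

Lemma closed_simplex_fsub s s' x :
  closed_simplex s x -> (forall v, v \notin s' -> x v = 0) -> (s' `<=` s)%fset ->
  closed_simplex s' x.
Proof.
move=> [x0 xs x1] xs' s's; split=> //.
by rewrite -x1; apply: big_fset_incl => // v _ /xs'.
Qed.

Lemma closed_simplex_le1 s x v : closed_simplex s x -> x v <= 1.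
Proof.
move=> [x0 xs x1]; have [vs|/xs->] := boolP (v \in s); last exact: ler01.
by rewrite -x1 (big_fsetD1 v) //= lerDl sumr_ge0.
Qed.

(** The initial value 1 does not affect the minimum over a nonempty [b], since barycentric
    coordinates are at most 1. *)
Definition least_coord b x : R := \big[Num.min/1]_(u <- b) x u.

Lemma least_coord_le b x u : u \in b -> least_coord b x <= x u.
Proof. by move=> ub; exact: ge_bigmin_seq. Qed.

Lemma least_coord_ge0 b x : (forall v, 0 <= x v) -> 0 <= least_coord b x.
Proof.
move=> x0; rewrite /least_coord; elim/big_ind: _ => // [p q p0 q0].
by rewrite le_min p0.
Qed.

Lemma least_coord_attained b x : b != fset0%fset -> (forall v, x v <= 1) ->
  exists2 u, u \in b & x u = least_coord b x.
Proof.
move=> /fset0Pn[w wb] x1.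
have [e|n1] := eqVneq (least_coord b x) 1.
  by exists w => //; apply/eqP; rewrite eq_le e x1 -e least_coord_le.
suff : least_coord b x = 1 \/ exists2 u, u \in b & x u = least_coord b x.
  by case=> // e; move: n1; rewrite e eqxx.
rewrite /least_coord big_seq; elim/big_ind: _ => [|p q hp hq|u ub].
- by left.
- by rewrite /Num.min; case: ifP.
- by right; exists u.
Qed.

(* The vertex of [a \ b] receives what the vertices of [b] lose, so that the
   sum of the coordinates is preserved. *)
Definition push b a x : V -> R := fun w =>
  least_coord b x * (#|` b|%:R * (w \in (a `\` b)%fset)%:R - (w \in b)%:R).

Lemma push_simplex b v x (c : R) : v \notin b ->
  closed_simplex (v |` b)%fset x -> 0 <= c <= 1 ->
  closed_simplex (v |` b)%fset (fun w => x w + c * push b (v |` b)%fset x w).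
Proof.
move=> vb xa /andP[c0 c1]; have [x0 xs x1] := xa.
have m0 := least_coord_ge0 b x0.
have inv w : (w \in ((v |` b) `\` b)%fset) = (w == v).
  rewrite !inE; have [->|] := eqVneq w v; first by rewrite vb.
  by rewrite /= andNb.
split.
- move=> w; rewrite /push inv; have [wb|wb] := boolP (w \in b).
    have [wv|_] := eqVneq w v; first by rewrite -wv wb in vb.
    have := least_coord_le x wb; rewrite mulr0 sub0r mulrN1 mulrN subr_ge0.
    by apply: le_trans; rewrite ler_piMl.
  by rewrite subr0 addr_ge0 // !mulr_ge0.
- move=> w wa; rewrite xs // /push inv; move: wa; rewrite !inE negb_or.
  by case/andP=> /negbTE-> /negbTE->; rewrite mulr0 subr0 mulr0 mulr0 addr0.
- rewrite big_split /= x1 -[RHS]addr0; congr (_ + _).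
  rewrite -mulr_sumr -mulr_sumr big_fsetU1 //= inv eqxx (negbTE vb) subr0 mulr1.
  rewrite (eq_big_seq (fun=> -1)); last first.
    move=> w wb /=; rewrite inv (wb : w \in b) .
    by case: eqVneq wb vb => [-> ->//|_ _ _]; rewrite mulr0 sub0r.
  by rewrite sumrN card_fset_sum1 natr_sum subrr !mulr0.
Qed.

(** The full push empties a vertex [u] of [b] where the minimum is attained, so the point lands in
    the face opposite [u], which still contains [v] and thus differs from [b]. *)
Lemma push_horn b v x : v \notin b -> b != fset0%fset ->
  closed_simplex (v |` b)%fset x ->
  exists2 u, u \in b & closed_simplex ((v |` b) `\ u)%fset
    (fun w => x w + push b (v |` b)%fset x w).
Proof.
move=> vb b0 xa; have := push_simplex (c := 1) vb xa.
rewrite ler01 lexx => /(_ isT).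
under eq_fun do rewrite mul1r.
move=> ya; have [u ub xu] := least_coord_attained b0 (fun w => closed_simplex_le1 w xa).
exists u => //; apply: (closed_simplex_fsub ya); last exact: fsubD1set.
move=> w; rewrite !inE negb_and negbK => /orP[/eqP->|wa].
  rewrite /push !inE ub /= mulr0 sub0r mulrN1 xu.
  by rewrite subrr.
by have [_ + _] := ya; apply; rewrite !inE.
Qed.

End Push.

(** * The topology of the realization *)

Section Topology.
Context {V : choiceType} {R : realType}.
Implicit Types (S : set {fset V}) (s : {fset V}).

Lemma ptws_continuousP (Z : topologicalType) (f : Z -> {ptws V -> R}) :
  continuous f <-> forall w, continuous (fun z => f z w).
Proof.
split=> [cf w z|cf z].
  exact: (continuous_comp (cf z) (@proj_continuous V (fun=> R) w (f z))).
apply/cvg_sup => w; exact: (@continuous_comp_initial _ Z R (@^~ w) f (cf w)).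
Qed.

Lemma closed_simplex_closed s : closed (closed_simplex s : set {ptws V -> R}).
Proof.
have pc (w : V) : continuous (fun x : {ptws V -> R} => x w).
  exact: (@proj_continuous V (fun=> R) w).
rewrite (_ : closed_simplex s =
    (\bigcap_v [set x : {ptws V -> R} | 0 <= x v]) `&`
    (\bigcap_(v in [set v | v \notin s]) [set x | x v = 0]) `&`
    [set x | \sum_(v <- s) x v = 1]); last first.
  apply/seteqP; split=> x.
    by move=> [x0 xs x1]; split=> //; split=> v; [move=> _; exact: x0|exact: xs].
  by move=> [[x0 xs] x1]; split=> [v||]; [exact: x0|exact: xs|exact: x1].
apply: closedI; first apply: closedI.
- apply: closed_bigI => v _; exact: ((continuous_closedP _).1 (pc v) _ (@closed_ge R 0)).
- apply: closed_bigI => v _; exact: ((continuous_closedP _).1 (pc v) _ (@closed_eq R 0)).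
- have /continuous_closedP : continuous (fun x : {ptws V -> R} => \sum_(v <- s) x v).
    by apply: continuous_big => [p|v _]; [exact: add_continuous|exact: pc].
  by move=> /(_ _ (@closed_eq R 1)).
Qed.

(** The weak topology may be finer than the pointwise one, but they agree on each closed simplex. As
    [F] has finitely many faces, the preimage of a closed set is a finite union of closed sets. *)
Lemma realization_continuous S (Z : topologicalType) (g : Z -> realization R S)
    (F : {fset V}) :
  continuous (fun z => bary (g z)) ->
  (forall z, exists s, [/\ S s, (s `<=` F)%fset & closed_simplex s (bary (g z))]) ->
  continuous g.
Proof.
move=> cg gF; apply/continuous_closedP => C cC.
have /realization_openP oC : open (~` C) by exact: closed_openC.
have /choice[W HW] : forall s, exists W : set {ptws V -> R}, S s -> open W /\
    forall x : realization R S, closed_simplex s (bary x) -> ((~` C) x <-> W (bary x)).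
  move=> s; have [Ss|nSs] := pselect (S s); last by exists setT.
  by have [W ? ?] := oC s Ss; exists W.
rewrite (_ : g @^-1` C = \bigcup_(s in [set` fpowerset F] `&` S)
   ((fun z => bary (g z)) @^-1` (closed_simplex s `&` ~` W s))).
  apply: closed_bigcup => [|s [_ /HW[oW _]]].
    exact/finite_setIl/finite_fset.
  apply: ((continuous_closedP _).1 cg); apply: closedI; first exact: closed_simplex_closed.
  exact: open_closedC.
apply/seteqP; split=> z.
  move=> Cz; have [s [Ss sF zs]] := gF z; exists s => /=.
    by split=> //; rewrite /= fpowersetE.
  by split=> // /(HW s Ss).2 ; apply.
move=> [s [_ Ss] [zs nW]] /=; apply: contrapT => nC; apply: nW.
by apply/((HW s Ss).2 _ zs).
Qed.

(* It is the local compactness of [R] that allows joint continuity on the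
   product to be tested on closed simplices. *)
Lemma realization_homotopy_continuous S (Y : topologicalType)
    (H : realization R S * R -> Y) :
  (forall s (Z : topologicalType) (f : Z -> realization R S) (k : Z -> R),
     S s -> (forall z, closed_simplex s (bary (f z))) ->
     continuous (fun z => bary (f z)) -> continuous k ->
     continuous (fun z => H (f z, k z))) ->
  continuous H.
Proof.
move=> cH [x0 t0] W nW.
have [s0 S0 xs0] : polyhedron S (bary x0) by exact: set_mem (valP x0).
have cx0 : continuous (fun t : R => H (x0, t)).
  by apply: (cH s0 R (fun=> x0) id) => // t; [exact: cvg_cst|exact: cvg_id].
move: nW; rewrite nbhsE => -[W' [oW' W'x] W'W].
have /nbhs_ballP[e /= e0 he] : nbhs t0 [set t | W' (H (x0, t))].
  by apply: cx0; apply: open_nbhs_nbhs.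
(* A compact neighbourhood of [t0] whose slice over [x0] is mapped into [W']. *)
pose J := `[t0 - e / 2, t0 + e / 2]%classic.
have JW t : J t -> W' (H (x0, t)).
  rewrite /J /= in_itv /= => tJ; apply: he; rewrite /ball /=.
  by rewrite ltr_norml; move/andP: tJ => [? ?]; apply/andP; split; lra.
have nJ : nbhs t0 J.
  apply: filterS (nbhsx_ballx t0 (e / 2) _); last by rewrite divr_gt0.
  move=> t; rewrite /ball /J /= in_itv /= ltr_norml => /andP[? ?].
  by apply/andP; split; lra.
pose U := [set x | forall t, J t -> W' (H (x, t))].
suff oU : open U.
  exists (U, J); first by split=> //; apply: open_nbhs_nbhs; split.
  by move=> [x t] [/= Ux Jt]; apply: W'W; exact: Ux.
apply/realization_openP => s Ss.
pose D := set_type (closed_simplex s : set {ptws V -> R}).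
have inS (z : D) : (set_val z : {ptws V -> R}) \in polyhedron S.
  by apply/mem_set; exists s => //; exact: set_mem (valP z).
pose f (z : D) : realization R S := SigSub (inS z).
have cval : continuous (set_val : D -> {ptws V -> R}) by exact: initial_continuous.
have cfH : continuous (fun p : D * R => H (f p.1, p.2)).
  apply: (cH s _ (fun p : D * R => f p.1) snd) => //.
  - by move=> p; exact: set_mem (valP p.1).
  - by move=> p; apply: (@continuous_comp _ _ _ fst set_val); [exact: cvg_fst|exact: cval].
  - by move=> p; exact: cvg_snd.
(* The tube lemma along the compact interval [J]. *)
have oUf : open (f @^-1` U).
  rewrite openE => z Uz; rewrite /interior.
  have cJ : compact J by exact: segment_compact.
  move/compact_near_coveringP/near_covering_withinP : cJ.
  move=> /(_ D (nbhs z) (fun z' t => W' (H (f z', t))) _); apply => t Jt.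
  have : nbhs (z, t) [set p : D * R | W' (H (f p.1, p.2))].
    by apply: cfH; apply: open_nbhs_nbhs; split=> //; exact: Uz.
  move=> [[A B] [/= nA nB] AB]; exists (B, A) => //= -[t' z'] [/= ? ?] _.
  exact: (AB (z', t')).
have [P oP Pf] := oUf.
exists P => // x xs; pose z : D := SigSub (mem_set xs).
have fz : f z = x by apply: val_inj.
have /seteqP[PU UP] := Pf.
by split=> [Ux|Px]; [apply: (UP z); rewrite /preimage /= fz|rewrite -fz; exact: (PU z)].
Qed.

End Topology.

(** * The deformation *)

Section Flow.
Context {V : choiceType} {R : realType}.
Context (S : set {fset V}) (M : set ({fset V} * {fset V})) (h : {fset V} -> nat).
Context (hS : simplicial_complex S) (hM : partial_matching S M).
Context (hcrit : subcomplex (critical S M) S).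
Context (rank0 : forall c, critical S M c -> h c = 0%N).
Context (rank_gt0 : forall c, matched M c -> (0 < h c)%N).
Context (rank_mate : forall b a, M (b, a) -> h b = h a).
Context (rank_face : forall b a c, M (b, a) -> (c `<` a)%fset ->
  c != fset0%fset -> c != b -> (h c < h a)%N).
Implicit Types (x : V -> R) (a b s : {fset V}) (n : nat) (t : R).

(** The subcomplex hypothesis enters here: faces of a critical simplex are critical, hence of rank
    0. For a matched simplex, [rank_face] applies to the larger simplex of its pair. *)
Lemma rank_le c s : S s -> (c `<=` s)%fset -> c != fset0%fset -> (h c <= h s)%N.
Proof.
move=> Ss cs c0; have [ks|nks] := pselect (critical S M s).
  rewrite rank0 //; case: hcrit => _ [_]; apply; [exact: ks|exact: cs|exact: c0].
have [b [a [Mba [e|e]]]] := not_critical_matched Ss nks; last first.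
  have [->//|nbc] := eqVneq c b; first by rewrite (rank_mate Mba) e.
  move: cs; rewrite e subEfproper => /orP[/eqP->//|ca].
  exact/ltnW/(rank_face Mba).
have [->//|ncb] := eqVneq c b; first by rewrite e.
rewrite e (rank_mate Mba) ltnW // (rank_face Mba) //.
by apply: fsub_proper_trans cs _; rewrite e; apply: matching_fsub hM _ _ Mba.
Qed.

(** The finite vertex set [F] keeps track of finiteness: it makes the sums below uniformly finite
    and supplies the bound that [realization_continuous] asks for. *)
Definition stratum n (F : {fset V}) : set (V -> R) :=
  [set x | exists s, [/\ S s, (h s <= n)%N, (s `<=` F)%fset & closed_simplex s x]].

Lemma stratum_le n m F F' :
  (n <= m)%N -> (F `<=` F')%fset -> stratum n F `<=` stratum m F'.
Proof.
move=> nm FF' x [s [Ss hs sF xs]]; exists s; split=> //.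
  exact: leq_trans nm.
exact: fsubset_trans FF'.
Qed.

Definition collapse_pair n b x : V -> R :=
  if `[< (exists a, M (b, a)) /\ h b = n >] then push b (upper_mate M b) x
  else fun=> 0.

(** A displacement, not a new position. On points of rank at most [n] at most one summand is
    nonzero, so the collapses of rank [n] do not interfere. *)
Definition collapse n x : V -> R :=
  fun w => \sum_(b \in [set: {fset V}]) collapse_pair n b x w.

Lemma collapse_pairE n b a x :
  M (b, a) -> h a = n -> collapse_pair n b x = push b a x.
Proof.
move=> Mba ha; rewrite /collapse_pair (upper_mateP hM Mba); case: asboolP => //.
by case; split; [exists a|rewrite (rank_mate Mba)].
Qed.

(** If [b] is not a face of [s], some coordinate of [x] on [b] vanishes and so does the push.
    Otherwise monotonicity of the rank forces [s] to have the rank of [b], which is possible only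
    within the pair of [b]. *)
Lemma collapse_pair_eq0 n b s x : S s -> (h s <= n)%N -> closed_simplex s x ->
  ~ (exists a, [/\ M (b, a), h b = n & s = b \/ s = a]) ->
  collapse_pair n b x = fun=> 0.
Proof.
move=> Ss hs xs nb; rewrite /collapse_pair; case: asboolP => // -[[a Mba] hb].
have [bs|/fsubsetPn[u ub us]] := boolP (b `<=` s)%fset; last first.
  apply/funext => w; rewrite /push (_ : least_coord b x = 0) ?mul0r //.
  have [x0 + _] := xs => /(_ u us) xu; apply/eqP; rewrite eq_le least_coord_ge0 //.
  by rewrite -xu least_coord_le.
have Sb : S b by have [] := matching_simplex hM Mba.
have b0 : b != fset0%fset by case: hS => + _; apply.
have hbs : h b = h s by apply/eqP; rewrite eqn_leq (rank_le Ss) //= hb.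
case: nb; exists a; split=> //.
move: bs; rewrite subEfproper => /orP[/eqP->|bs]; first by left.
right; have [ks|nks] := pselect (critical S M s).
  have mb : matched M b by exists b, a; split=> //; left.
  by have := rank_gt0 mb; rewrite hbs rank0.
have [b' [a' [Mba' e]]] := not_critical_matched Ss nks.
have hs' : h s = h a' by case: e => ->; rewrite ?(rank_mate Mba').
have sa' : (s `<=` a')%fset.
  by case: e => ->; rewrite // fproper_sub // (matching_fsub hM).
have [bb'|nbb'] := eqVneq b b'.
  case: e => e; first by move: bs; rewrite e bb' (negbTE (fproper_irrefl _)).
  rewrite e; move: Mba'; rewrite -bb' => Mba'.
  by rewrite -(upper_mateP hM Mba) (upper_mateP hM Mba').
(* Now [b] is a proper face of [a'] other than its mate, so its rank would be smaller than that of
   [s]. *)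
have := rank_face Mba' (fproper_sub_trans bs sa') b0 nbb'.
by rewrite hbs hs' ltnn.
Qed.

Lemma collapse_eq0 n s x : S s -> (h s <= n)%N -> closed_simplex s x ->
  collapse n.+1 x = fun=> 0.
Proof.
move=> Ss hs xs; apply/funext => w; apply: fsbig1 => b _.
rewrite (collapse_pair_eq0 (s := s) Ss (leqW hs) xs) // => -[a [Mba hb e]].
suff e' : h s = n.+1 by move: hs; rewrite e' ltnn.
by case: e => ->; rewrite -?(rank_mate Mba).
Qed.

Lemma collapseE b a s x n : M (b, a) -> h a = n -> s = b \/ s = a ->
  closed_simplex s x -> collapse n x = push b a x.
Proof.
move=> Mba ha e xs; have [Sb Sa] := matching_simplex hM Mba.
have Ss : S s by case: e => ->.
have hs : h s = n by case: e => ->; rewrite ?(rank_mate Mba).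
apply/funext => w; rewrite /collapse (@fsbigTE _ _ _ _ [fset b]%fset) => [|b'].
  by rewrite big_seq_fset1 (collapse_pairE _ Mba).
rewrite inE => bb'; rewrite (collapse_pair_eq0 Ss _ xs) ?hs // => -[a' [Mba' _ e']].
by have [E _] := matching_share hM Mba Mba' e e'; rewrite E eqxx in bb'.
Qed.

(** The index set no longer depends on [x], as the proof of continuity requires. *)
Lemma collapse_sum n F x w : stratum n F x ->
  collapse n x w = \sum_(b <- fpowerset F) collapse_pair n b x w.
Proof.
move=> [s [Ss hs sF xs]]; apply: fsbigTE => b; rewrite fpowersetE => bF.
rewrite (collapse_pair_eq0 Ss hs xs) // => -[a [Mba _ e]]; case/negP: bF.
apply: fsubset_trans sF; case: e => -> //.
by rewrite fproper_sub // (matching_fsub hM).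
Qed.

Lemma stratum_case n F x : stratum n.+1 F x ->
  (stratum n F x /\ collapse n.+1 x = fun=> 0) \/
  exists b a, [/\ M (b, a), h a = n.+1, (b `<=` F)%fset, closed_simplex a x
                & collapse n.+1 x = push b a x].
Proof.
move=> [s [Ss hs sF xs]]; have [hn|hn] := leqP (h s) n.
  by left; split; [exists s|exact: collapse_eq0 xs].
have {hn}hs : h s = n.+1 by apply/eqP; rewrite eqn_leq hs.
right; have [/rank0|nks] := pselect (critical S M s); first by rewrite hs.
have [b [a [Mba e]]] := not_critical_matched Ss nks.
have ha : h a = n.+1 by rewrite -hs; case: e => ->; rewrite ?(rank_mate Mba).
have ba := fproper_sub (matching_fsub hM Mba).
exists b, a; split=> //; last exact: collapseE e xs.
  by apply: fsubset_trans sF; case: e => ->.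
by apply: closed_simplex_sub xs; case: e => ->.
Qed.

Lemma stratum_collapse n F : exists F' : {fset V}, forall x, stratum n.+1 F x ->
  stratum n F' (fun w => x w + collapse n.+1 x w) /\
  forall c : R, 0 <= c <= 1 -> stratum n.+1 F' (fun w => x w + c * collapse n.+1 x w).
Proof.
(* A point of [b] may be pushed towards a vertex outside [F], so the upper mates of all faces of [F]
   are added, before [x] is given. *)
pose F' := (F `|` \bigcup_(b <- fpowerset F) upper_mate M b)%fset.
exists F' => x /stratum_case[].
  move=> [xn ->] /=; have xF := stratum_le (leqnn n) (fsubsetUl F _ : F `<=` F')%fset xn.
  split=> [|c _]; under [fun w => x w + _]eq_fun do rewrite ?mulr0 addr0.
    exact: xF.
  exact: (stratum_le (leqnSn n) (fsubset_refl _) xF).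
move=> [b [a [Mba ha bF xa ->]]].
have [Sb Sa] := matching_simplex hM Mba.
have aF' : (a `<=` F')%fset.
  apply: fsubset_trans (fsubsetUr _ _); rewrite -(upper_mateP hM Mba).
  by apply: bigfcup_sup; rewrite ?fpowersetE.
have b0 : b != fset0%fset by case: hS => + _; apply.
have [v vb av] := matching_fsetU1 hM Mba.
split=> [|c c01]; last first.
  by exists a; split; rewrite ?ha //; move: xa; rewrite av => xa; exact: (push_simplex vb xa).
have [u ub xu] : exists2 u, u \in b &
    closed_simplex (a `\ u)%fset (fun w => x w + push b a x w).
  by move: xa; rewrite av => xa; exact: (push_horn vb b0 xa).
have vu : v \in (a `\ u)%fset.
  by rewrite av !inE eqxx /= andbT; apply: contra vb => /eqP->.
have au0 : (a `\ u)%fset != fset0%fset by apply/fset0Pn; exists v.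
have ua : u \in a by rewrite av !inE ub orbT.
exists (a `\ u)%fset; split=> //.
- by case: hS => _; apply; [exact: Sa|exact: fsubD1set|].
- rewrite -ltnS -ha; apply: (rank_face Mba) => //; first exact: fproperD1.
  by apply: contraNneq vb => <-.
- exact: fsubset_trans (fsubD1set _ _) aF'.
Qed.

(* [ramp n] decreases from 1 to 0 on the interval [2^-n, 2^(1-n)], during which
   the pairs of rank [n] are collapsed. *)
Definition ramp n t : R := Num.min 1 (Num.max 0 (2 - 2 ^+ n * t)).

Lemma ramp01 n t : 0 <= ramp n t <= 1.
Proof. by rewrite /ramp le_min ler01 le_max lexx /= ge_min lexx. Qed.

Lemma ramp1 n t : 2 ^+ n * t <= 1 -> ramp n t = 1.
Proof. by move=> t1; rewrite /ramp (max_idPr _) ?(min_idPl _) //; lra. Qed.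

Lemma ramp0 n t : 2 <= 2 ^+ n * t -> ramp n t = 0.
Proof. by move=> t2; rewrite /ramp (max_idPl _) ?(min_idPr _) //; lra. Qed.

(** While the ramp is positive the inner flow is still the identity, and this is the partial
    collapse of rank [n]; afterwards it is the flow of the collapsed point. The single formula makes
    continuity immediate at the junction. *)
Fixpoint flow n x t : V -> R :=
  if n is k.+1 then
    fun w => flow k (fun u => x u + collapse n x u) t w - ramp n t * collapse n x w
  else x.

Lemma flow_id n x t : 2 ^+ n * t <= 1 -> flow n x t = x.
Proof.
elim: n x => // n IH x t1; apply/funext => w /=; rewrite ramp1 // IH ?mul1r ?addrK //.
(* Time ranges over all reals, and doubling increases $2^n t$ only for positive [t]. *)
have [t0|t0] := leP t 0.
  by apply: le_trans ler01; rewrite mulr_ge0_le0 // exprn_ge0.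
by apply: le_trans t1; rewrite exprS ler_pM2r // ler_peMl ?exprn_ge0 ?ler1n.
Qed.

(** The collapse of rank $n+1$ ends at time $2^{-n}$, exactly when that of rank $n$ may start. *)
Lemma flowS_early n x t : 2 ^+ n * t <= 1 ->
  flow n.+1 x t = fun w => x w + (1 - ramp n.+1 t) * collapse n.+1 x w.
Proof.
by move=> t1; apply/funext => w /=; rewrite flow_id // mulrBl mul1r addrA.
Qed.

Lemma flowS_late n x t : 1 <= 2 ^+ n * t ->
  flow n.+1 x t = flow n (fun w => x w + collapse n.+1 x w) t.
Proof.
move=> t1; apply/funext => w /=; rewrite ramp0 ?mul0r ?subr0 //.
by rewrite exprS -mulrA; lra.
Qed.

Lemma flow_stratum n F : exists F' : {fset V}, forall x t,
  stratum n F x -> stratum n F' (flow n x t).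
Proof.
elim: n F => [|n IH] F; first by exists F.
have [F1 HF1] := stratum_collapse n F; have [F2 HF2] := IH F1.
exists (F1 `|` F2)%fset => x t /HF1[x1 x2].
have [t1|/ltW t1] := leP (2 ^+ n * t) 1.
  rewrite flowS_early //; apply: (stratum_le (leqnn _) (fsubsetUl _ _)).
  by apply: x2; have /andP[? ?] := ramp01 n.+1 t; lra.
by rewrite flowS_late //; apply: (stratum_le (leqnSn _) (fsubsetUr _ _)); exact: HF2.
Qed.

(** For every rank $n \ge 1$ the interval ends at $2^{1-n} \le 1$, so at time 1 all collapses are
    complete and each has lowered the rank. *)
Lemma flow_end n F x : stratum n F x -> exists F', stratum 0 F' (flow n x 1).
Proof.
elim: n F x => [|n IH] F x xF; first by exists F.
have [F1 /(_ x xF)[x1 _]] := stratum_collapse n F.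
rewrite flowS_late; first exact: IH x1.
by rewrite mulr1 exprn_ege1 // ler1n.
Qed.

(** Collapses of rank above [n] do not move [x], so the infinite concatenation is well defined. *)
Lemma flow_stable n m F x t : stratum n F x -> (n <= m)%N ->
  flow m x t = flow n x t.
Proof.
move=> xF; elim: m => [|m IH]; first by rewrite leqn0 => /eqP->.
rewrite leq_eqVlt ltnS => /orP[/eqP->//|nm]; rewrite -IH //.
have [s [Ss hs _ xs]] := xF; apply/funext => w /=.
rewrite (collapse_eq0 Ss (leq_trans hs nm) xs) /= mulr0 subr0.
by under [fun u => x u + _]eq_fun do rewrite addr0.
Qed.

Lemma flow_strata n m F F' x t : stratum n F x -> stratum m F' x ->
  flow n x t = flow m x t.
Proof.
move=> xF xF'; have [nm|/ltnW mn] := leqP n m.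
  by rewrite (flow_stable _ xF).
by rewrite (flow_stable _ xF').
Qed.

(** * Joint continuity of the flow in point and time *)

Lemma ramp_continuous n : continuous (ramp n).
Proof.
have c1 : continuous (fun _ : R => 1 : R) by move=> t; exact: cvg_cst.
have c0 : continuous (fun _ : R => 0 : R) by move=> t; exact: cvg_cst.
have cl : continuous (fun t : R => 2 - 2 ^+ n * t).
  move=> t; apply: cvgB; first exact: cvg_cst.
  exact: mulrl_continuous.
move=> t; exact: (continuous_min (c1 t) (continuous_max (c0 t) (cl t))).
Qed.

Lemma least_coord_continuous (Z : topologicalType) (f : Z -> V -> R) b :
  (forall w, continuous (f ^~ w)) -> continuous (fun z => least_coord b (f z)).
Proof.
move=> cf; rewrite /least_coord; apply: continuous_big => [p|w _]; last exact: cf.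
by apply: continuous_min; [exact: cvg_fst|exact: cvg_snd].
Qed.

Lemma collapse_pair_continuous (Z : topologicalType) (f : Z -> V -> R) n b w :
  (forall v, continuous (f ^~ v)) ->
  continuous (fun z => collapse_pair n b (f z) w).
Proof.
move=> cf z; rewrite /collapse_pair; case: asboolP => _; last exact: cvg_cst.
by apply: cvgM; [exact: least_coord_continuous|exact: cvg_cst].
Qed.

Lemma collapse_continuous (Z : topologicalType) (f : Z -> V -> R) n F w :
  (forall v, continuous (f ^~ v)) -> (forall z, stratum n F (f z)) ->
  continuous (fun z => collapse n (f z) w).
Proof.
move=> cf fF; under eq_fun do
  rewrite (collapse_sum _ (fF _)).
apply: continuous_big => [p|b _]; first exact: add_continuous.
exact: collapse_pair_continuous.
Qed.

Lemma flow_continuous (Z : topologicalType) (f : Z -> V -> R) (k : Z -> R) n F w :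
  (forall v, continuous (f ^~ v)) -> continuous k ->
  (forall z, stratum n F (f z)) ->
  continuous (fun z => flow n (f z) (k z) w).
Proof.
move=> + ck; elim: n f F w => [|n IH] f F w cf fF; first exact: cf.
have cc v : continuous (fun z => collapse n.+1 (f z) v).
  exact: collapse_continuous cf fF.
have [F' HF'] := stratum_collapse n F.
move=> z /=; apply: cvgB; last apply: cvgM; last exact: cc.
  apply: (IH _ F') => [v y|y]; last by have [] := HF' _ (fF y).
  by apply: cvgD; [exact: cf|exact: cc].
exact: (continuous_comp (ck z) (@ramp_continuous n.+1 (k z))).
Qed.

End Flow.

(** * The homotopy on the realization *)

Theorem proposition2p9 (R : realType) (V : choiceType) (hV : [set: V] !=set0)
    (S : set {fset V}) (hS : simplicial_complex S)
    (hconn : connected [set: realization R S])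
    (M : set ({fset V} * {fset V})) (hM : partial_matching S M)
    (hacyclic : acyclic_matching S M) (hbounded : bounded_matching S M)
    (hcrit : subcomplex (critical S M) S) :
  deformation_retract R (subrealization R S (critical S M)).
Proof.
have [h [r0 rp rm rf]] := exists_rank hS hM hacyclic hbounded.
have /choice[car Hcar] : forall x : realization R S, exists s,
    S s /\ closed_simplex s (bary x).
  by move=> x; have [s ? ?] := set_mem (valP x); exists s.
(* The chosen simplex [car x] need not vary continuously with [x]; by [flow_strata] any simplex
   containing [x] gives the same flow, so a fixed one can be used on each closed simplex. *)
pose Phi (x : realization R S) t := flow M h (h (car x)) (bary x) t.
have in_stratum s (x : V -> R) : S s -> closed_simplex s x -> stratum S h (h s) s x.
  by move=> Ss xs; exists s; split.
have PhiE s x t : S s -> closed_simplex s (bary x) ->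
    Phi x t = flow M h (h s) (bary x) t.
  move=> Ss xs; have [Sc xc] := Hcar x.
  by apply: (flow_strata hS hM hcrit r0 rp rm rf) _ _; exact: in_stratum.
have flowS := flow_stratum (R := R) hS hM hcrit r0 rp rm rf.
have PhiS x t : polyhedron S (Phi x t).
  have [Sc xc] := Hcar x.
  have [F' /(_ _ t (in_stratum _ _ Sc xc))] := flowS (h (car x)) (car x).
  by move=> [s [Ss _ _ ?]]; exists s.
pose H (p : realization R S * R) : realization R S := SigSub (mem_set (PhiS p.1 p.2)).
have HE p : bary (H p) = Phi p.1 p.2 by [].
have H_fixed (x : realization R S) t :
    subrealization R S (critical S M) x -> H (x, t) = x.
  move=> [s ks xs]; have [Ss _] := ks; apply: val_inj.
  by rewrite -[LHS]/(Phi x t) (PhiE s) // r0.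
exists H; split.
- apply: continuous_subspaceT => p; move: p; apply: realization_homotopy_continuous.
  move=> s Z f k Ss fs cf ck.
  have [F' HF'] := flowS (h s) s.
  apply: (realization_continuous (F := F')).
    apply/ptws_continuousP => w.
    under eq_fun do rewrite HE /= (PhiE s) //.
    apply: (flow_continuous hS hM hcrit r0 rp rm rf (F := s)) => //.
      by apply/ptws_continuousP.
    by move=> z; exact: in_stratum.
  move=> z; have [s' [Ss' _ s'F xs']] := HF' _ (k z) (in_stratum _ _ Ss (fs z)).
  by exists s'; split=> //; rewrite HE /= (PhiE s).
- move=> x; apply: val_inj; rewrite -[LHS]/(Phi x 0).
  by apply: flow_id; rewrite mulr0.
- move=> x; have [Sc xc] := Hcar x.
  have [F' [s [Ss hs _ xs]]] :=
    flow_end hS hM hcrit r0 rp rm rf (in_stratum _ _ Sc xc).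
  exists s; last exact: xs.
  (* At time 1 the point lies in a simplex of rank 0, which is critical because matched simplices
     have positive rank. *)
  apply: contrapT => /(not_critical_matched Ss) /rp.
  by rewrite ltnNge hs.
- by move=> x t Ax _; exact: H_fixed.
Qed.
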